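(* Let $\alpha: I\subset\mathbb{R}\to\mathbb{E}^3$ be a curve with strictly positive curvature $\kappa$ and torsion $\tau$, parametrized by arclength $s$, and let $f$ be an integrable function. The curve $\alpha$ is congruent to an $f$-rectifying curve if and only if the ratio of torsion and curvature of the curve is $$\frac{\tau}{\kappa}=\overline{\mu}\,F(s),$$ where $F$ is the primitive of $f$ and $\overline{\mu}$ is a nonzero constant. Moreover: (i) if $f\equiv 0$, we have the helix condition for $\alpha$, i.e. $\frac{\tau}{\kappa}$ is a nonzero constant; (ii) if $f$ is a nonzero constant function, $\alpha$ is congruent to a rectifying curve, i.e. $\left(\frac{\tau}{\kappa}\right)'$ is a nonzero constant; (iii) if $f$ is a polynomial of degree $n$, then $\alpha$ has the characterization that $\left(\frac{\tau}{\kappa}\right)^{(n+1)}$ is a nonzero constant.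
   Context: $\mathbb{E}^3$ is Euclidean 3-space with standard inner product. For a curve $\alpha$ parametrized by arclength $s$, $T=\alpha'$ is the unit tangent, $\kappa=|T'|$ the curvature, and (where $\kappa\neq0$) $N$ the principal normal, $B=T\times N$ the binormal, and $\tau$ the torsion, so that $T'=\kappa N$, $N'=-\kappa T+\tau B$, $B'=-\tau N$. The rectifying plane at $s$ is the plane spanned by $T(s)$ and $B(s)$. For an integrable function $f$ of the parameter $s$, the $f$-position vector of $\alpha$ is $\alpha_f(s)=\int f(s)T(s)\,ds$, i.e. an antiderivative of $fT$. The curve $\alpha$ is called $f$-rectifying if its $f$-position vector always lies in the rectifying plane of $\alpha$, i.e. $\alpha_f(s)=\lambda(s)T(s)+\mu(s)B(s)$ for some real functions $\lambda,\mu$. ''The primitive $F$ of $f$'' is an antiderivative of $f$, $F'=f$ (antiderivatives being determined up to an additive constant). A helix is a curve whose tangent vector makes a constant angle with a fixed direction. A rectifying curve is a space curve whose position vector always lies in its rectifying plane. Congruent means equal up to a rigid motion of $\mathbb{E}^3$. The items (i)-(iii) concern the curves $\alpha$ of the equivalence, according to the choice of $f$. Superscripts in parentheses denote derivatives with respect to $s$.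
   Formalization: In the definition of an f-rectifying curve the f-position vector is required not to be identically zero; otherwise for f ≡ 0 the zero vector would make every curve f-rectifying and the equivalence and (i) would fail. *)

(* Defs.v *)
From HB Require Import structures.
From mathcomp Require Import all_boot all_order all_algebra.
From mathcomp Require Import all_classical all_reals all_analysis.

Set Implicit Arguments.
Unset Strict Implicit.
Unset Printing Implicit Defensive.

Import Order.TTheory GRing.Theory Num.Theory.
Import numFieldNormedType.Exports.

Local Open Scope ring_scope.
Local Open Scope classical_set_scope.

(* Euclidean 3-space is 'rV[R]_3.  The norm `|u| that the library puts on
   matrices is the sup norm: it is used only for the topology (derivatives do
   not depend on the choice of norm); Euclidean lengths are given by enorm. *)
Section Euclidean.
Context {R : realType}.
Implicit Types u v : 'rV[R]_3.

Definition dot u v : R := \sum_(i < 3) u 0 i * v 0 i.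

Definition enorm u : R := Num.sqrt (dot u u).

(* Indices are read modulo 3: u 0 (i + 1) stands for u_(i+1 mod 3). *)
Definition cross u v : 'rV[R]_3 :=
  \row_(i < 3) (u 0 (i + 1) * v 0 (i + 2%:R) - u 0 (i + 2%:R) * v 0 (i + 1)).

End Euclidean.

Section Derivatives.
Context {R : realType}.

(* The domains I below are open, so that two-sided derivatives at the points of
   I only depend on the restriction of the functions to I. *)
Definition antiderivative_on {V : normedModType R} (I : set R)
    (g G : R -> V) : Prop :=
  forall s, I s -> is_derive s 1 G (g s).

Definition n_derivable_on {V : normedModType R} (I : set R) (n : nat)
    (g : R -> V) : Prop :=
  forall k, (k < n)%N -> forall s, I s -> derivable g^`(k) s 1.

Definition nonzero_constant_on (I : set R) (h : R -> R) : Prop :=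
  exists2 c : R, c != 0 & forall s, I s -> h s = c.

(* Since derive1n is total, existence of the derivatives is explicit. *)
Definition nth_derivative_nonzero_constant_on (I : set R) (n : nat)
    (h : R -> R) : Prop :=
  n_derivable_on I n h /\ nonzero_constant_on I h^`(n).

End Derivatives.

Section FrenetApparatus.
Context {R : realType}.
Implicit Types (I : set R) (a : R -> 'rV[R]_3) (s : R).

Definition tangent a : R -> 'rV[R]_3 := a^`().

Definition curvature a s : R := enorm ((tangent a)^`()%classic s).

Definition principal_normal a s : 'rV[R]_3 :=
  (curvature a s)^-1 *: (tangent a)^`()%classic s.

Definition binormal a s : 'rV[R]_3 :=
  cross (tangent a s) (principal_normal a s).

(* Sign convention: B' = - tau N. *)
Definition torsion a s : R :=
  - dot ((binormal a)^`()%classic s) (principal_normal a s).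

Definition torsion_curvature_ratio a s : R := torsion a s / curvature a s.

(* Three continuous derivatives is the regularity needed for the torsion to be
   defined and continuous. *)
Definition unit_speed_curve I a : Prop :=
  [/\ n_derivable_on I 3 a,
      forall s, I s -> {for s, continuous a^`(3)} &
      forall s, I s -> enorm (tangent a s) = 1].

(* The vector x s lies in the rectifying plane span(T(s), B(s)) of the curve a,
   for every parameter s in I. *)
Definition in_rectifying_planes I a (x : R -> 'rV[R]_3) : Prop :=
  exists lambda mu : R -> R, forall s, I s ->
    x s = lambda s *: tangent a s + mu s *: binormal a s.

(* The f-position vector (here p) is an antiderivative of f T, determined up to
   an additive constant vector.  It is required not to be the zero function:
   p = 0 is an antiderivative of f T only if f = 0 on I, and without this
   requirement every curve would be f-rectifying for f = 0. *)
Definition f_rectifying I (f : R -> R) a : Prop :=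
  exists p : R -> 'rV[R]_3,
    [/\ antiderivative_on I (fun s => f s *: tangent a s) p,
        exists2 s, I s & p s != 0 &
        in_rectifying_planes I a p].

Definition rectifying I a : Prop := in_rectifying_planes I a a.

Definition helix I a : Prop :=
  exists (u : 'rV[R]_3) (theta : R), enorm u = 1 /\
    forall s, I s -> dot (tangent a s) u = cos theta.

(* Points are row vectors, so that rotations act by right multiplication. *)
Definition congruent I a (b : R -> 'rV[R]_3) : Prop :=
  exists (Q : 'M[R]_3) (v : 'rV[R]_3),
    [/\ Q *m Q^T = 1%:M, \det Q = 1 & forall s, I s -> b s = a s *m Q + v].

Definition congruent_to_f_rectifying I (f : R -> R) a : Prop :=
  exists2 b, congruent I a b & f_rectifying I f b.

Definition congruent_to_rectifying I a : Prop :=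
  exists2 b, congruent I a b & rectifying I b.

Definition polynomial_of_degree_on I (n : nat) (f : R -> R) : Prop :=
  exists2 p : {poly R}, size p = n.+1 & forall s, I s -> f s = p.[s].

End FrenetApparatus.

(* Main.v *)
Require Import Defs.
From HB Require Import structures.
From mathcomp Require Import all_boot all_order all_algebra.
From mathcomp Require Import ring lra.
From mathcomp Require Import all_classical all_reals all_analysis.

Set Implicit Arguments.
Unset Strict Implicit.
Unset Printing Implicit Defensive.

Import Order.TTheory GRing.Theory Num.Theory.
Import numFieldNormedType.Exports.

Local Open Scope ring_scope.
Local Open Scope classical_set_scope.

(** Let [T], [N], [B] be the Frenet frame of the curve, [kappa] and [tau] its
    curvature and torsion. A position vector [p], with [p' = f T], lies in the
    rectifying planes exactly when it is orthogonal to [N], so that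
    [p = lambda T + mu B] with [lambda = p . T] and [mu = p . B]. The Frenet
    equations turn the derivatives of the three inner products of [p] with the
    frame into

      [lambda' = f],    [mu' = 0],    [tau mu = kappa lambda].

    Hence [mu] is a constant, [lambda] is a primitive [F] of [f], and
    [tau / kappa = mu^-1 F]; the constant [mu] is nonzero because [mu = 0] would
    give [lambda = 0] and then [p = 0] ([f_rectifying_ratio]). Conversely, if
    [tau / kappa = mu F] with [F' = f], then [p = F T + mu^-1 B] satisfies
    [p' = f T], the two normal components of its derivative cancelling
    ([is_derive_ratio_position]). Being [f]-rectifying is invariant under rigid
    motions since a rotation carries the tangents and normals of one curve to
    those of the other ([congruent_f_rectifying]).

    The three special cases come from this vector [p]. For [f = 0] both [p] and
    [F] are constant, so [p] spans the axis of a helix ([zero_f_helix]). For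
    [f = c] with [c] nonzero, [c^-1 p] has derivative [T], hence is a translate
    of the curve ([constant_f_rectifying]). For [f] a polynomial of degree [n],
    [F] is one of degree [n + 1], and on an interval the functions whose
    derivative of order [n + 1] is a nonzero constant are the polynomials of
    degree [n + 1] ([polynomial_nth_derivative],
    [nth_derivative_polynomial]). *)

(** * Inner and vector products *)

Section EuclideanAlgebra.
Context {R : realType}.
Implicit Types u v w : 'rV[R]_3.

Lemma dot_mulmx u v : dot u v = (u *m v^T) 0 0.
Proof. by rewrite mxE; apply: eq_bigr => i _; rewrite mxE. Qed.

Lemma dotC u v : dot u v = dot v u.
Proof. by apply: eq_bigr => i _; rewrite mulrC. Qed.

Lemma dotDl u v w : dot (u + v) w = dot u w + dot v w.
Proof. by rewrite !dot_mulmx mulmxDl mxE. Qed.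

Lemma dotZl (k : R) u v : dot (k *: u) v = k * dot u v.
Proof. by rewrite !dot_mulmx -scalemxAl mxE. Qed.

Lemma dotZr (k : R) u v : dot u (k *: v) = k * dot u v.
Proof. by rewrite dotC dotZl dotC. Qed.

Lemma dotDr u v w : dot u (v + w) = dot u v + dot u w.
Proof. by rewrite dotC dotDl !(dotC u). Qed.

Lemma dot_ge0 u : 0 <= dot u u.
Proof. by apply: sumr_ge0 => i _; rewrite -expr2 sqr_ge0. Qed.

Lemma sqr_enorm u : enorm u ^+ 2 = dot u u.
Proof. exact/sqr_sqrtr/dot_ge0. Qed.

Lemma dot_rotate (Q : 'M[R]_3) u v :
  Q *m Q^T = 1%:M -> dot (u *m Q) (v *m Q) = dot u v.
Proof.
by move=> QQ; rewrite !dot_mulmx trmx_mul -mulmxA (mulmxA Q) QQ mul1mx.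
Qed.

Lemma dot3E u v :
  dot u v = u 0 0 * v 0 0 + u 0 1 * v 0 1 + u 0 2%:R * v 0 2%:R.
Proof.
rewrite /dot !big_ord_recr big_ord0 /= add0r.
by congr (u 0 _ * v 0 _ + u 0 _ * v 0 _ + u 0 _ * v 0 _); apply: val_inj.
Qed.

Lemma cross3E u v :
  [/\ cross u v 0 0 = u 0 1 * v 0 2%:R - u 0 2%:R * v 0 1,
      cross u v 0 1 = u 0 2%:R * v 0 0 - u 0 0 * v 0 2%:R &
      cross u v 0 2%:R = u 0 0 * v 0 1 - u 0 1 * v 0 0].
Proof.
by split; rewrite mxE;
  congr (u 0 _ * v 0 _ - u 0 _ * v 0 _); apply: val_inj.
Qed.

Lemma dot_crossl u v : dot (cross u v) u = 0.
Proof. by rewrite dot3E; have [-> -> ->] := cross3E u v; ring. Qed.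

Lemma dot_crossr u v : dot (cross u v) v = 0.
Proof. by rewrite dot3E; have [-> -> ->] := cross3E u v; ring. Qed.

Lemma dot_cross_cross u v :
  dot (cross u v) (cross u v) = dot u u * dot v v - dot u v ^+ 2.
Proof. by rewrite !dot3E; have [-> -> ->] := cross3E u v; ring. Qed.

(** Three orthonormal rows form a matrix [M] with [M *m M^T = 1], hence also
    with [M^T *m M = 1]; read on a row vector, the latter identity is the
    expansion along the rows. *)
Lemma orthonormal_expansion (e : 'I_3 -> 'rV[R]_3) w :
  (forall i j, dot (e i) (e j) = (i == j)%:R) ->
  w = \sum_i dot w (e i) *: e i.
Proof.
move=> e_on; pose M : 'M[R]_3 := \matrix_i e i.
have MMT : M *m M^T = 1%:M.
  apply/matrixP => i j; rewrite !mxE -e_on; apply: eq_bigr => k _.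
  by rewrite !mxE.
rewrite -[LHS]mulmx1 -(mulmx1C MMT) mulmxA mulmx_sum_row.
apply: eq_bigr => i _; rewrite rowK; congr (_ *: _).
by rewrite mxE; apply: eq_bigr => k _; rewrite !mxE.
Qed.

(** The third vector of the frame is the cross product, of unit length by the
    identity of Lagrange. *)
Lemma frame_expansion u v w :
  dot u u = 1 -> dot v v = 1 -> dot u v = 0 ->
  w = dot w u *: u + dot w v *: v + dot w (cross u v) *: cross u v.
Proof.
move=> uu vv uv; pose e (i : 'I_3) := nth 0 [:: u; v; cross u v] i.
have cc : dot (cross u v) (cross u v) = 1.
  by rewrite dot_cross_cross uu vv uv expr0n subr0 mulr1.
have e_on i j : dot (e i) (e j) = (i == j)%:R.
  by case: i => [[|[|[|//]]] ?]; case: j => [[|[|[|//]]] ?];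
    rewrite /e //= -?val_eqE //= 1?dotC ?dot_crossl ?dot_crossr // 1?dotC
            ?dot_crossl ?dot_crossr.
by rewrite [LHS](orthonormal_expansion w e_on) !big_ord_recr big_ord0 /= add0r.
Qed.

End EuclideanAlgebra.

(** * Derivatives of vector-valued functions *)

Section VectorDerivatives.
Context {R : realType}.
Implicit Types (g h : R -> 'rV[R]_3) (s : R) (I : set R).

Lemma is_derive_mxP (m n : nat) (M : R -> 'M[R]_(m, n)) s dM :
  is_derive s 1 M dM <->
  forall i j, is_derive s 1 (fun t => M t i j) (dM i j).
Proof.
split=> [[dvM <-] i j|dvM].
  apply: DeriveDef; first exact: (derivable_mxP _ _ _).1.
  by rewrite derive_mx // mxE.
have M_derivable : derivable M s 1.
  by apply/derivable_mxP => i j; have [] := dvM i j.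
apply: DeriveDef => //; rewrite derive_mx //.
by apply/matrixP => i j; rewrite mxE; have [] := dvM i j.
Qed.

Lemma is_derive_dot g h s dg dh :
  is_derive s 1 g dg -> is_derive s 1 h dh ->
  is_derive s 1 (fun t => dot (g t) (h t)) (dot dg (h s) + dot (g s) dh).
Proof.
move=> /is_derive_mxP dvg /is_derive_mxP dvh.
have -> : (fun t => dot (g t) (h t)) =
    \sum_(i < 3) ((fun t => g t 0 i) * (fun t => h t 0 i)).
  by apply/funext => t; rewrite fct_sumE.
apply: is_derive_eq.
rewrite /dot -big_split; apply: eq_bigr => i _ /=.
by rewrite addrC /GRing.scale /= (mulrC (h s 0 i)).
Qed.

Lemma is_derive_mulmxr (l m n : nat) (g : R -> 'M[R]_(l, m)) s dg
    (Q : 'M[R]_(m, n)) :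
  is_derive s 1 g dg -> is_derive s 1 (fun t => g t *m Q) (dg *m Q).
Proof.
move=> /is_derive_mxP dvg; apply/is_derive_mxP => i j.
have -> : (fun t => (g t *m Q) i j) =
    \sum_(k < m) (Q k j *: (fun t => g t i k)).
  by apply/funext => t; rewrite fct_sumE mxE; apply: eq_bigr => k _;
    rewrite mulrC.
apply: is_derive_eq.
by rewrite mxE; apply: eq_bigr => k _; rewrite mulrC.
Qed.

Lemma is_derive_scale (m n : nat) (k : R -> R) (g : R -> 'M[R]_(m, n)) s dk dg :
  is_derive s 1 k dk -> is_derive s 1 g dg ->
  is_derive s 1 (fun t => k t *: g t) (dk *: g s + k s *: dg).
Proof.
move=> dvk /is_derive_mxP dvg; apply/is_derive_mxP => i j.
have -> : (fun t => (k t *: g t) i j) = k * (fun t => g t i j).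
  by apply/funext => t; rewrite mxE.
apply: is_derive_eq.
by rewrite !mxE /GRing.scale /=; ring.
Qed.

Lemma derivable_cross g h s :
  derivable g s 1 -> derivable h s 1 ->
  derivable (fun t => cross (g t) (h t)) s 1.
Proof.
move=> /derivable_mxP dvg /derivable_mxP dvh; apply/derivable_mxP => i j.
have -> : (fun t => cross (g t) (h t) i j) =
    (fun t => g t 0 (j + 1)) * (fun t => h t 0 (j + 2%:R)) -
    (fun t => g t 0 (j + 2%:R)) * (fun t => h t 0 (j + 1)).
  by apply/funext => t; rewrite mxE.
by apply: derivableB; apply: derivableM.
Qed.

Lemma derivable1_is_derive (V : normedModType R) (g : R -> V) s :
  derivable g s 1 -> is_derive s 1 g (g^`()%classic s).
Proof. by move=> dvg; rewrite derive1E; exact: derivableP. Qed.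

Lemma derive1_val (V : normedModType R) (g : R -> V) s dg :
  is_derive s 1 g dg -> g^`()%classic s = dg.
Proof. by move=> dvg; rewrite derive1E derive_val. Qed.

(** Openness of [I] makes the derivative at a point of [I] depend only on the
    values on [I]. *)
Lemma eq_on_is_derive (V : normedModType R) I (g h : R -> V) s dg :
  open I -> I s -> (forall t, I t -> g t = h t) ->
  is_derive s 1 g dg -> is_derive s 1 h dg.
Proof.
move=> oI Is gh; apply: near_eq_is_derive; apply: filterS gh _.
exact: open_nbhs_nbhs.
Qed.

Lemma derivative_of_constant_on (V : normedModType R) I (g : R -> V) s c dg :
  open I -> I s -> (forall t, I t -> g t = c) ->
  is_derive s 1 g dg -> dg = 0.
Proof.
move=> oI Is gc /(eq_on_is_derive oI Is gc) dgc.
by rewrite -(derive_cst c s 1) (derive_val (is_derive := dgc)).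
Qed.

(** The product rule for an inner product that is constant along the curve: the
    Frenet equations are read off from this identity. *)
Lemma derivative_of_constant_dot I g h s c dg dh :
  open I -> I s -> (forall t, I t -> dot (g t) (h t) = c) ->
  is_derive s 1 g dg -> is_derive s 1 h dh ->
  dot dg (h s) = - dot (g s) dh.
Proof.
move=> oI Is ghc dvg dvh; apply/eqP; rewrite -addr_eq0; apply/eqP.
exact: (derivative_of_constant_on oI Is ghc) (is_derive_dot dvg dvh).
Qed.

Lemma zero_derivative_constant I (g : R -> R) :
  is_interval I -> (forall s, I s -> is_derive s 1 g 0) ->
  forall s t, I s -> I t -> g s = g t.
Proof.
move=> itvI dg0.
suff H s t : I s -> I t -> s < t -> g s = g t.
  move=> s t Is It; case: (ltgtP s t) => [|ts|->//]; first exact: H.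
  by apply/esym/H.
move=> Is It st.
have Iin x : x \in `[s, t]%R -> I x.
  by rewrite in_itv /=; apply: itvI Is It x.
have [||c _ /eqP] := @MVT R g (cst 0) s t st.
- by move=> x xst; apply/dg0/Iin; apply: subset_itv_oo_cc xst.
- apply: derivable_within_continuous => x /Iin/dg0 dgx.
  exact: ex_derive.
- by rewrite mul0r subr_eq0 => /eqP.
Qed.

Lemma zero_derivative_constant_mx (m n : nat) I (g : R -> 'M[R]_(m, n)) :
  is_interval I -> (forall s, I s -> is_derive s 1 g 0) ->
  forall s t, I s -> I t -> g s = g t.
Proof.
move=> itvI dg0 s t Is It; apply/matrixP => i j.
apply: (zero_derivative_constant (g := fun x => g x i j) itvI) => // x Ix.
by have /is_derive_mxP/(_ i j) := dg0 x Ix; rewrite mxE.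
Qed.

Lemma antiderivative_unique I (g h dg : R -> R) :
  I !=set0 -> is_interval I ->
  antiderivative_on I dg g -> antiderivative_on I dg h ->
  exists c, forall s, I s -> g s = h s + c.
Proof.
move=> [s0 Is0] itvI dvg dvh; exists (g s0 - h s0) => s Is.
suff e : g s - h s = g s0 - h s0 by rewrite -e addrC subrK.
apply: (zero_derivative_constant (g := g - h) itvI) => // t It.
have dgt := dvg t It; have dht := dvh t It.
by apply: is_derive_eq; rewrite subrr.
Qed.

End VectorDerivatives.

(** * Polynomial functions and iterated derivatives *)

Section FormalDerivative.
Local Open Scope ring_scope.

Lemma size_deriv_num (R : numDomainType) (p : {poly R}) n :
  size p = n.+2 -> size p^`() = n.+1.
Proof.
move=> sz_p; rewrite /deriv sz_p size_poly_eq //=.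
by rewrite mulrn_eq0 negb_or -[p`_n.+1]/(p`_n.+2.-1) -sz_p -lead_coefE
           lead_coef_eq0 -size_poly_eq0 sz_p.
Qed.

Lemma poly_primitive (R : numFieldType) (p : {poly R}) n :
  size p = n.+1 -> exists2 q : {poly R}, q^`() = p & size q = n.+2.
Proof.
(* The coefficient of index 0 is p`_0 / 0, which is 0. *)
move=> sz_p; exists (\poly_(i < n.+2) (p`_i.-1 / i%:R)); last first.
  rewrite size_poly_eq //= mulf_neq0 ?invr_eq0 ?pnatr_eq0 //.
  by rewrite -[p`_n]/(p`_n.+1.-1) -sz_p -lead_coefE lead_coef_eq0 -size_poly_eq0
             sz_p.
apply/polyP => i; rewrite coef_deriv coef_poly ltnS.
case: ltnP => [_|n_i] /=; last by rewrite mul0rn nth_default ?sz_p.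
by rewrite -[LHS]mulr_natr divfK ?pnatr_eq0.
Qed.

End FormalDerivative.

Section PolynomialsOnIntervals.
Local Open Scope ring_scope.
Context {R : realType}.
Implicit Types (I : set R) (h : R -> R) (p q : {poly R}).

Lemma polynomial_nth_derivative I h n q :
  open I -> size q = n.+1 -> (forall s, I s -> h s = q.[s]) ->
  nth_derivative_nonzero_constant_on I n h.
Proof.
move=> oI sz_q hq.
have der k s : I s -> h^`(k)%classic s = q^`(k).[s].
  elim: k s => [|k IHk] s Is; first by rewrite derive1n0 derivn0 hq.
  rewrite derive1nS derivnS; apply: derive1_val.
  by apply: (eq_on_is_derive oI Is (fun t It => esym (IHk t It))).
split=> [k _ s Is|].
  by have [] := eq_on_is_derive oI Is (fun t It => esym (der k t It))
    (is_derive_poly _ _).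
(* The formal derivative of order n keeps only n! times the leading
   coefficient. *)
exists (q`_n *+ n`!) => [|s Is].
  rewrite mulrn_eq0 negb_or -lt0n fact_gt0 -[n]/(n.+1.-1) -sz_q -lead_coefE.
  by rewrite lead_coef_eq0 -size_poly_eq0 sz_q.
rewrite der // [q^`(n)]size1_polyC ?hornerC ?coef_derivn ?addn0 ?ffactnn //.
apply/leq_sizeP => j j1; rewrite coef_derivn nth_default ?mul0rn //.
by rewrite sz_q -addn1 leq_add2l.
Qed.

Lemma antiderivative_polynomial I h n p :
  I !=set0 -> is_interval I -> size p = n.+1 ->
  antiderivative_on I (horner p) h ->
  exists2 q : {poly R}, size q = n.+2 & forall s, I s -> h s = q.[s].
Proof.
move=> I0 itvI sz_p dvh; have [q dq sz_q] := poly_primitive sz_p.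
have dvq : antiderivative_on I (horner p) (horner q).
  by move=> s _; rewrite -dq; exact: is_derive_poly.
have [c hqc] := antiderivative_unique I0 itvI dvh dvq.
exists (q + c%:P) => [|s Is]; last by rewrite hornerD hornerC hqc.
by rewrite size_polyDl ?sz_q // (leq_ltn_trans (size_polyC_leq1 c)).
Qed.

(** Induction on the order: the derivative of [h] is a polynomial by the
    induction hypothesis, and [h] differs from a formal primitive of it by a
    constant because [I] is an interval. *)
Lemma nth_derivative_polynomial I h n :
  I !=set0 -> is_interval I ->
  nth_derivative_nonzero_constant_on I n h ->
  exists2 q : {poly R}, size q = n.+1 & forall s, I s -> h s = q.[s].
Proof.
move=> I0 itvI; elim: n h => [|n IHn] h [dvh [c c0 hc]].
  exists c%:P => [|s Is]; first by rewrite size_polyC c0.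
  by rewrite hornerC -(hc s Is).
have [|p sz_p dhp] := IHn h^`()%classic.
  split=> [k kn s Is|]; first by rewrite -derive1Sn; exact: dvh.
  by exists c => // s Is; rewrite -derive1Sn hc.
apply: (antiderivative_polynomial I0 itvI sz_p) => s Is.
by rewrite -dhp //; apply: derivable1_is_derive; exact: (dvh 0%N).
Qed.

End PolynomialsOnIntervals.

(** * The Frenet frame *)

Section FrenetFrame.
Context {R : realType} (I : set R) (a : R -> 'rV[R]_3).
Hypothesis I_open : open I.
Hypothesis a_unit_speed : unit_speed_curve I a.
Hypothesis curvature_gt0 : forall s, I s -> 0 < curvature a s.

Local Notation T := (tangent a).
Local Notation N := (principal_normal a).
Local Notation B := (binormal a).
Local Notation kappa := (curvature a).
Local Notation tau := (torsion a).

Lemma is_derive_curve s : I s -> is_derive s 1 a (T s).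
Proof.
move=> Is; have [dva _ _] := a_unit_speed.
by apply: derivable1_is_derive; exact: (dva 0%N).
Qed.

Lemma is_derive_tangent s : I s -> is_derive s 1 T (kappa s *: N s).
Proof.
move=> Is; have [dva _ _] := a_unit_speed.
have k0 : kappa s != 0 by rewrite gt_eqF // curvature_gt0.
rewrite /principal_normal scalerA (divff k0) scale1r.
by apply: derivable1_is_derive; exact: (dva 1%N).
Qed.

Lemma dot_tangent_tangent s : I s -> dot (T s) (T s) = 1.
Proof.
move=> Is; have [_ _ unit_T] := a_unit_speed.
by rewrite -sqr_enorm unit_T // expr1n.
Qed.

Lemma dot_normal_normal s : I s -> dot (N s) (N s) = 1.
Proof.
move=> Is; rewrite dotZl dotZr -sqr_enorm -/(kappa s).
by have := curvature_gt0 Is; move: (kappa s) => k k0; field; rewrite gt_eqF.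
Qed.

Lemma dot_tangent_normal s : I s -> dot (T s) (N s) = 0.
Proof.
move=> Is; have dT := is_derive_tangent Is.
have := derivative_of_constant_dot I_open Is dot_tangent_tangent dT dT.
rewrite dotC => /eqP; rewrite -addr_eq0 dotZr -mulr2n mulrn_eq0 /= mulf_eq0.
by rewrite gt_eqF ?curvature_gt0 //= => /eqP.
Qed.

Lemma dot_binormal_binormal s : I s -> dot (B s) (B s) = 1.
Proof.
move=> Is; rewrite dot_cross_cross dot_tangent_tangent // dot_normal_normal //.
by rewrite dot_tangent_normal // expr0n subr0 mulr1.
Qed.

Lemma frenet_expansion s w :
  I s -> w = dot w (T s) *: T s + dot w (N s) *: N s + dot w (B s) *: B s.
Proof.
move=> Is; apply: frame_expansion.
- exact: dot_tangent_tangent.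
- exact: dot_normal_normal.
- exact: dot_tangent_normal.
Qed.

(** [N] is [T'] divided by its length, and the square root is differentiable
    at the positive number [T' . T']. *)
Lemma derivable_normal s : I s -> derivable N s 1.
Proof.
move=> Is; have [dva _ _] := a_unit_speed.
have dT' : derivable (T^`()%classic) s 1 by exact: (dva 2%N).
have k0 := curvature_gt0 Is.
have dk : derivable kappa s 1.
  have dT'' := derivable1_is_derive dT'.
  have dTT := is_derive_dot dT'' dT''.
  have TT0 : 0 < dot (T^`()%classic s) (T^`()%classic s).
    by rewrite -sqr_enorm exprn_gt0.
  by have [] := is_derive1_comp (is_derive1_sqrt TT0) dTT.
have dki : derivable (fun t => (kappa t)^-1) s 1.
  by apply: derivableV => //; rewrite gt_eqF.
by have [] :=
  is_derive_scale (derivable1_is_derive dki) (derivable1_is_derive dT').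
Qed.

Lemma derivable_binormal s : I s -> derivable B s 1.
Proof.
move=> Is; apply: derivable_cross; last exact: derivable_normal.
by have [] := is_derive_tangent Is.
Qed.

(** The coordinates of [B'] in the frame come from differentiating the
    constant inner products [B . T = 0] and [B . B = 1]; the coordinate along
    [N] is the torsion by definition. *)
Lemma is_derive_binormal s : I s -> is_derive s 1 B (- tau s *: N s).
Proof.
move=> Is; have dB := derivable1_is_derive (derivable_binormal Is).
have dT := is_derive_tangent Is.
apply: is_derive_eq; rewrite [LHS](frenet_expansion _ Is).
have -> : dot (B^`()%classic s) (T s) = 0.
  rewrite (derivative_of_constant_dot I_open Is _ dB dT (c := 0)); last first.
    by move=> t It; exact: dot_crossl.
  by rewrite dotZr dot_crossr mulr0 oppr0.
have -> : dot (B^`()%classic s) (B s) = 0.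
  have := derivative_of_constant_dot I_open Is dot_binormal_binormal dB dB.
  by rewrite (dotC (B s)) => /eqP; rewrite -addr_eq0 -mulr2n mulrn_eq0 => /eqP.
by rewrite !scale0r add0r addr0 /torsion opprK.
Qed.

(** Likewise for [N']; its coordinates follow from the derivatives of [T] and
    [B] by differentiating [N . T = 0], [N . N = 1] and [N . B = 0]. *)
Lemma is_derive_normal s :
  I s -> is_derive s 1 N (- kappa s *: T s + tau s *: B s).
Proof.
move=> Is; have dN := derivable1_is_derive (derivable_normal Is).
have dT := is_derive_tangent Is; have dB := is_derive_binormal Is.
apply: is_derive_eq; rewrite [LHS](frenet_expansion _ Is).
have -> : dot (N^`()%classic s) (T s) = - kappa s.
  rewrite (derivative_of_constant_dot I_open Is _ dN dT (c := 0)); last first.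
    by move=> t It; rewrite dotC dot_tangent_normal.
  by rewrite dotZr dot_normal_normal // mulr1.
have -> : dot (N^`()%classic s) (N s) = 0.
  have := derivative_of_constant_dot I_open Is dot_normal_normal dN dN.
  by rewrite (dotC (N s)) => /eqP; rewrite -addr_eq0 -mulr2n mulrn_eq0 => /eqP.
have -> : dot (N^`()%classic s) (B s) = tau s.
  rewrite (derivative_of_constant_dot I_open Is _ dN dB (c := 0)); last first.
    by move=> t It; rewrite dotC dot_crossr.
  by rewrite dotZr dot_normal_normal // mulr1 opprK.
by rewrite scale0r addr0.
Qed.

(** Trades the unknown coordinate functions for a single equation, which can be
    differentiated and transported along rotations. *)
Lemma in_rectifying_planesP (x : R -> 'rV[R]_3) :
  in_rectifying_planes I a x <-> forall s, I s -> dot (x s) (N s) = 0.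
Proof.
split=> [[l [m xlm]] s Is|xN].
  by rewrite xlm // dotDl !dotZl dot_tangent_normal // dot_crossr !mulr0 addr0.
exists (fun s => dot (x s) (T s)), (fun s => dot (x s) (B s)) => s Is.
by rewrite [LHS](frenet_expansion _ Is) xN // scale0r addr0.
Qed.

(** For a position vector [p = lambda T + mu B], differentiating the three
    inner products of [p] with the frame gives [lambda' = f], [mu' = 0] and
    [tau mu = kappa lambda]. A vanishing [mu] would force [lambda], hence [p],
    to vanish, since the curvature does not. *)
Lemma f_rectifying_ratio f :
  is_interval I -> f_rectifying I f a ->
  exists F mu, [/\ antiderivative_on I f F, mu != 0 &
    forall s, I s -> torsion_curvature_ratio a s = mu * F s].
Proof.
move=> itvI [p [dp [s0 Is0 p0] /in_rectifying_planesP pN]].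
pose lambda s := dot (p s) (T s); pose mu s := dot (p s) (B s).
have lambda' : antiderivative_on I f lambda.
  move=> s Is; have dps := dp s Is; have dT := is_derive_tangent Is.
  apply: (is_derive_eq (is_derive_dot dps dT)).
  by rewrite dotZl dotZr pN // dot_tangent_tangent // mulr0 addr0 mulr1.
have mu_cst s : I s -> mu s = mu s0.
  move=> Is; apply: (zero_derivative_constant itvI) Is Is0 => t It.
  apply: (is_derive_eq (is_derive_dot (dp t It) (is_derive_binormal It))).
  by rewrite dotZl dotZr pN // dotC dot_crossl !mulr0 addr0.
have ratio s : I s -> tau s * mu s0 = kappa s * lambda s.
  move=> Is; have := derivative_of_constant_dot I_open Is pN (dp s Is)
    (is_derive_normal Is).
  rewrite dotZl dot_tangent_normal // mulr0 dotDr !dotZr -/(lambda s) -/(mu s).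
  by rewrite mu_cst // => /esym/eqP; rewrite oppr_eq0 mulNr addrC subr_eq0 =>
    /eqP.
have mu0 : mu s0 != 0.
  apply: contraNneq p0 => mu0; move/eqP: (ratio s0 Is0).
  rewrite mu0 mulr0 eq_sym mulf_eq0 gt_eqF ?curvature_gt0 //= => /eqP lambda0.
  rewrite (frenet_expansion (p s0) Is0) -/(lambda s0) -/(mu s0) lambda0 mu0.
  by rewrite pN // !scale0r !addr0.
exists lambda, (mu s0)^-1; split=> [//||s Is]; first by rewrite invr_eq0.
rewrite /torsion_curvature_ratio -[tau s](mulfK mu0) ratio //.
by field; rewrite mu0 gt_eqF ?curvature_gt0.
Qed.

(** The only candidate for a position vector when [tau / kappa = mu F]: its
    coordinate along [T] is a primitive of [f], and the coordinate along [B] is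
    the constant that makes the ratio of the two equal to [tau / kappa]. *)
Definition ratio_position (F : R -> R) (mu : R) s : 'rV[R]_3 :=
  F s *: T s + mu^-1 *: B s.

(** The normal component of the derivative is [F kappa - mu^-1 tau], which is
    zero by the hypothesis on the ratio. *)
Lemma is_derive_ratio_position (f F : R -> R) mu :
  antiderivative_on I f F -> mu != 0 ->
  (forall s, I s -> torsion_curvature_ratio a s = mu * F s) ->
  antiderivative_on I (fun s => f s *: T s) (ratio_position F mu).
Proof.
move=> dF mu0 ratio s Is.
have dFT := is_derive_scale (dF s Is) (is_derive_tangent Is).
have dB := is_derive_binormal Is.
have k0 : kappa s != 0 by rewrite gt_eqF // curvature_gt0.
have tauE : tau s = mu * F s * kappa s by rewrite -ratio // divfK.
have N0 : F s * kappa s + mu^-1 * - tau s = 0 by rewrite tauE; field.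
apply: (is_derive_eq (is_deriveD dFT (is_deriveZ mu^-1 dB))).
by rewrite -addrA (scalerA (F s)) (scalerA mu^-1) -scalerDl N0 scale0r addr0.
Qed.

Lemma dot_ratio_position_tangent F mu s :
  I s -> dot (ratio_position F mu s) (T s) = F s.
Proof.
by move=> Is; rewrite dotDl !dotZl dot_tangent_tangent // dot_crossl mulr0
  addr0 mulr1.
Qed.

Lemma ratio_position_neq0 F mu s : I s -> mu != 0 -> ratio_position F mu s != 0.
Proof.
move=> Is mu0; apply: contraNneq mu0 => p0.
have : dot (ratio_position F mu s) (B s) = mu^-1.
  by rewrite dotDl !dotZl dot_binormal_binormal // dotC dot_crossl mulr0
    add0r mulr1.
by rewrite p0 -[0 in LHS](scale0r (B s)) dotZl mul0r => /esym/eqP;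
  rewrite invr_eq0.
Qed.

Lemma ratio_f_rectifying (f F : R -> R) mu :
  I !=set0 -> antiderivative_on I f F -> mu != 0 ->
  (forall s, I s -> torsion_curvature_ratio a s = mu * F s) ->
  f_rectifying I f a.
Proof.
move=> [s0 Is0] dF mu0 ratio; exists (ratio_position F mu); split.
- exact: is_derive_ratio_position.
- by exists s0 => //; exact: ratio_position_neq0.
- by exists F, (cst mu^-1).
Qed.

(** * Congruent curves *)

Lemma congruent_frame b (Q : 'M[R]_3) v s :
  Q *m Q^T = 1%:M -> (forall t, I t -> b t = a t *m Q + v) -> I s ->
  tangent b s = T s *m Q /\ principal_normal b s = N s *m Q.
Proof.
move=> QQ baQ Is.
have Tb t : I t -> tangent b t = T t *m Q.
  move=> It; apply: derive1_val.
  apply: (eq_on_is_derive I_open It (fun u Iu => esym (baQ u Iu))).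
  have daQ := is_derive_mulmxr Q (is_derive_curve It).
  have dv := is_derive_cst v t 1.
  by apply: (is_derive_eq (is_deriveD daQ dv)); rewrite addr0.
split; first exact: Tb.
have dTb : (tangent b)^`()%classic s = T^`()%classic s *m Q.
  apply: derive1_val.
  apply: (eq_on_is_derive I_open Is (fun t It => esym (Tb t It))).
  apply: is_derive_mulmxr; apply: derivable1_is_derive.
  by have [] := is_derive_tangent Is.
rewrite /principal_normal /curvature dTb /enorm dot_rotate //.
by rewrite scalemxAl.
Qed.

(** Rotating a position vector [p] of the congruent curve back by [Q^T] yields
    one of [a]. Membership in the rectifying plane is orthogonality to the
    normal, so the binormals need not be compared. *)
Lemma congruent_f_rectifying f :
  congruent_to_f_rectifying I f a -> f_rectifying I f a.
Proof.
move=> [b [Q [v [QQ _ baQ]]] [p [dp [s0 Is0 p0] [l [m plm]]]]].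
have QTQ : Q^T *m Q = 1%:M := mulmx1C QQ.
exists (fun s => p s *m Q^T); split.
- move=> s Is; have [Tb _] := congruent_frame QQ baQ Is.
  apply: (is_derive_eq (is_derive_mulmxr Q^T (dp s Is))).
  by rewrite Tb -scalemxAl -mulmxA QQ mulmx1.
- exists s0 => //; apply: contraNneq p0 => pQ0.
  by rewrite -[p s0]mulmx1 -QTQ mulmxA pQ0 mul0mx.
apply/in_rectifying_planesP => s Is.
have [Tb Nb] := congruent_frame QQ baQ Is.
rewrite -(dot_rotate _ _ QQ) -mulmxA QTQ mulmx1 -Nb plm // dotDl !dotZl.
by rewrite dot_crossr Tb Nb dot_rotate // dot_tangent_normal // !mulr0 addr0.
Qed.

Lemma f_rectifying_congruent f :
  f_rectifying I f a -> congruent_to_f_rectifying I f a.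
Proof.
move=> a_rect; exists a => //; exists 1%:M, 0.
by split=> [||s _]; rewrite ?trmx1 ?mulmx1 ?det1 ?addr0.
Qed.

(** When [f = 0] the position vector is a constant vector, whose inner product
    with [T] is the antiderivative [F], itself constant: normalized, it is the
    axis of the helix. *)
Lemma zero_f_helix (f : R -> R) :
  I !=set0 -> is_interval I -> (forall s, I s -> f s = 0) ->
  (exists F mu, [/\ antiderivative_on I f F, mu != 0 &
    forall s, I s -> torsion_curvature_ratio a s = mu * F s]) ->
  helix I a.
Proof.
move=> [s0 Is0] itvI f0 [F [mu [dF mu0 ratio]]].
pose p := ratio_position F mu.
have p_cst s : I s -> p s = p s0.
  move=> Is; apply: (zero_derivative_constant_mx itvI) Is Is0 => t It.
  apply: (is_derive_eq (is_derive_ratio_position dF mu0 ratio It)).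
  by rewrite f0 // scale0r.
have F_cst s : I s -> F s = F s0.
  move=> Is; apply: (zero_derivative_constant itvI) Is Is0 => t It.
  by rewrite -(f0 t It); exact: dF.
have pp : dot (p s0) (p s0) = F s0 ^+ 2 + mu^-1 ^+ 2.
  rewrite dotDr !dotZr dot_ratio_position_tangent // /p dotDl !dotZl.
  rewrite dot_binormal_binormal // (dotC (T s0)) dot_crossl.
  by rewrite mulr0 add0r mulr1 !expr2.
pose e := enorm (p s0).
have e2 : e ^+ 2 = F s0 ^+ 2 + mu^-1 ^+ 2 by rewrite sqr_enorm.
have m2 : 0 < mu^-1 ^+ 2 by rewrite exprn_even_gt0 ?invr_eq0.
have e0 : 0 < e.
  rewrite lt_def sqrtr_ge0 andbT; apply: contraTneq m2 => e_0.
  have := sqr_ge0 (F s0); move: e2; rewrite e_0; lra.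
(* By Cauchy-Schwarz F s0 / e, the cosine of the angle, lies in [-1, 1]; here
   it is immediate since e^2 - F(s0)^2 = mu^-2. *)
exists (e^-1 *: p s0), (acos (e^-1 * F s0)); split.
  by rewrite /enorm dotZl dotZr -sqr_enorm -/e mulrA -expr2 -exprMn mulVf
    ?gt_eqF // expr1n sqrtr1.
move=> s Is; rewrite dotC dotZl -(p_cst s Is) dot_ratio_position_tangent //.
rewrite F_cst // acosK // in_itv /= ler_pdivrMl // ler_pdivlMl //.
apply/andP; split; nra.
Qed.

(** When [f] is a constant [c], both [c^-1 p] and [a] are antiderivatives of
    [T], so they differ by a translation. *)
Lemma constant_f_rectifying (f : R -> R) :
  I !=set0 -> is_interval I -> nonzero_constant_on I f ->
  (exists F mu, [/\ antiderivative_on I f F, mu != 0 &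
    forall s, I s -> torsion_curvature_ratio a s = mu * F s]) ->
  congruent_to_rectifying I a.
Proof.
move=> [s0 Is0] itvI [c c0 fc] [F [mu [dF mu0 ratio]]].
pose p := ratio_position F mu; pose q s := c^-1 *: p s - a s.
have q_cst s : I s -> q s = q s0.
  move=> Is; apply: (zero_derivative_constant_mx itvI) Is Is0 => t It.
  have dp := is_derive_ratio_position dF mu0 ratio It.
  apply: (is_derive_eq (is_deriveB (is_deriveZ c^-1 dp) (is_derive_curve It))).
  by rewrite fc // scalerA mulVf // scale1r subrr.
have QQ : (1%:M : 'M[R]_3) *m 1%:M^T = 1%:M by rewrite trmx1 mulmx1.
pose b s := a s *m 1%:M + q s0.
have ba s : I s -> b s = a s *m 1%:M + q s0 by [].
exists b; first by exists 1%:M, (q s0); split=> //; rewrite det1.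
exists (fun s => c^-1 * F s), (cst (c^-1 * mu^-1)) => s Is.
have [Tb Nb] := congruent_frame QQ ba Is.
rewrite /binormal Tb Nb !mulmx1 ba // mulmx1 -(q_cst s Is) /q addrC subrK.
by rewrite /p /ratio_position scalerDr !scalerA.
Qed.

End FrenetFrame.

(** * The characterization *)

Theorem theorem3 (R : realType) (I : set R) (alpha : R -> 'rV[R]_3)
    (f : R -> R)
    (I_open : open I) (I_interval : is_interval I) (I_nonempty : I !=set0)
    (alpha_unit_speed : unit_speed_curve I alpha)
    (curvature_gt0 : forall s, I s -> 0 < curvature alpha s)
    (torsion_gt0 : forall s, I s -> 0 < torsion alpha s)
    (f_integrable : locally_integrable I f) :
  [/\ congruent_to_f_rectifying I f alpha <->
        (exists (F : R -> R) (mu : R),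
          [/\ antiderivative_on I f F, mu != 0 &
              forall s, I s -> torsion_curvature_ratio alpha s = mu * F s]),
      (* (i) *)
      (forall s, I s -> f s = 0) ->
        congruent_to_f_rectifying I f alpha ->
        helix I alpha /\
        nonzero_constant_on I (torsion_curvature_ratio alpha),
      (* (ii) *)
      nonzero_constant_on I f ->
        congruent_to_f_rectifying I f alpha ->
        congruent_to_rectifying I alpha /\
        nth_derivative_nonzero_constant_on I 1 (torsion_curvature_ratio alpha) &
      (* (iii) *)
      forall n : nat,
        (polynomial_of_degree_on I n f ->
           congruent_to_f_rectifying I f alpha ->
           nth_derivative_nonzero_constant_on I n.+1
             (torsion_curvature_ratio alpha)) /\
        (nth_derivative_nonzero_constant_on I n.+1
             (torsion_curvature_ratio alpha) ->
           exists2 g : R -> R, polynomial_of_degree_on I n g &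
             congruent_to_f_rectifying I g alpha)].
Proof.
have charact g : congruent_to_f_rectifying I g alpha <->
    exists (F : R -> R) (mu : R),
      [/\ antiderivative_on I g F, mu != 0 &
          forall s, I s -> torsion_curvature_ratio alpha s = mu * F s].
  split=> [/(congruent_f_rectifying I_open alpha_unit_speed curvature_gt0)|].
    exact: f_rectifying_ratio.
  move=> [F [mu [dF mu0 ratio]]]; apply: f_rectifying_congruent.
  exact: ratio_f_rectifying dF mu0 ratio.
have polynomial_ratio n : polynomial_of_degree_on I n f ->
    congruent_to_f_rectifying I f alpha ->
    nth_derivative_nonzero_constant_on I n.+1 (torsion_curvature_ratio alpha).
  move=> [p sz_p fp] /charact[F [mu [dF mu0 ratio]]].
  have dFp : antiderivative_on I (horner p) F.
    by move=> s Is; rewrite -fp //; exact: dF.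
  have [q sz_q Fq] := antiderivative_polynomial I_nonempty I_interval sz_p dFp.
  apply: (@polynomial_nth_derivative _ _ _ _ (mu *: q)) => //.
    by rewrite size_scale.
  by move=> s Is; rewrite hornerZ ratio // Fq.
split=> [|f0 rect|f_cst rect|n].
- exact: charact.
- split; first exact/(zero_f_helix I_open alpha_unit_speed curvature_gt0
      I_nonempty I_interval f0)/charact.
  have /charact[F [mu [dF mu0 ratio]]] := rect.
  have [s0 Is0] := I_nonempty.
  have F_cst s : I s -> F s = F s0.
    move=> Is; apply: (zero_derivative_constant I_interval) Is Is0 => t It.
    by rewrite -(f0 t It); exact: dF.
  exists (mu * F s0) => [|s Is]; last by rewrite ratio // F_cst.
  by rewrite -ratio // mulf_neq0 ?invr_eq0 // gt_eqF // ?torsion_gt0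
             ?curvature_gt0.
- split; first exact/(constant_f_rectifying I_open
      alpha_unit_speed curvature_gt0 I_nonempty I_interval f_cst)/charact.
  have [c c0 fc] := f_cst; apply: polynomial_ratio => //.
  by exists c%:P => [|s Is]; rewrite ?size_polyC ?c0 // hornerC fc.
split=> [|ratio_deriv]; first exact: polynomial_ratio.
have [q sz_q ratio_q] :=
  nth_derivative_polynomial I_nonempty I_interval ratio_deriv.
exists (horner (deriv q)).
  by exists (deriv q) => //; exact: size_deriv_num.
apply/charact; exists (horner q), 1; split=> [s _||s Is].
- exact: is_derive_poly.
- exact: oner_neq0.
- by rewrite mul1r ratio_q.
Qed.
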